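(* Every hyperfinite tracially complete $C^*$-algebra is amenable.
   Context: A trace means a tracial state; $T(A)$ is the set of traces on $A$ with the weak$^*$ topology, and $\|a\|_{2,X}=\sup_{\tau\in X}\tau(a^*a)^{1/2}$ for $X\subseteq T(A)$. A tracially complete $C^*$-algebra is a pair $(\mathcal M,X)$ where $\mathcal M$ is a $C^*$-algebra and $X\subseteq T(\mathcal M)$ is compact and convex such that $\|\cdot\|_{2,X}$ is a norm and the operator-norm closed unit ball of $\mathcal M$ is $\|\cdot\|_{2,X}$-complete. $(\mathcal M,X)$ is hyperfinite if for every finite $\mathcal F\subseteq\mathcal M$ and $\epsilon>0$ there is a finite dimensional $C^*$-subalgebra $F\subseteq\mathcal M$ such that for every $a\in\mathcal F$ there is $b\in F$ with $\|a-b\|_{2,X}<\epsilon$. $(\mathcal M,X)$ is amenable if there are nets of finite dimensional $C^*$-algebras $F_\lambda$ and completely positive maps $\psi_\lambda\colon\mathcal M\to F_\lambda$, $\phi_\lambda\colon F_\lambda\to\mathcal M$ with $\|\phi_\lambda(\psi_\lambda(a))-a\|_{2,X}\to0$ for all $a\in\mathcal M$. *)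

(* Defs.v *)
From HB Require Import structures.
From mathcomp Require Import all_boot all_order all_algebra.
From mathcomp Require Import complex.
From mathcomp Require Import all_classical all_reals all_analysis.

Set Implicit Arguments.
Unset Strict Implicit.
Unset Printing Implicit Defensive.

Import Order.TTheory GRing.Theory Num.Theory.
Import numFieldNormedType.Exports.

Local Open Scope classical_set_scope.
Local Open Scope complex_scope.
Local Open Scope ring_scope.

(* C*-algebras are not assumed to be unital (nor nonzero), hence the product
   is not a MathComp ring multiplication. *)
HB.mixin Record isCstarAlgebra (R : realType) A
    & CompleteNormedModule R[i] A := {
  amul : A -> A -> A ;
  adj : A -> A ;
  amulA : forall a b c : A, amul a (amul b c) = amul (amul a b) c ;
  amulDZl : forall (k : R[i]) (a b c : A),
    amul (k *: a + b) c = k *: amul a c + amul b c ;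
  amulDZr : forall (k : R[i]) (a b c : A),
    amul c (k *: a + b) = k *: amul c a + amul c b ;
  adjDZ : forall (k : R[i]) (a b : A),
    adj (k *: a + b) = Num.conj k *: adj a + adj b ;
  adjK : forall a : A, adj (adj a) = a ;
  adjM : forall a b : A, adj (amul a b) = amul (adj b) (adj a) ;
  norm_amul : forall a b : A, `|amul a b| <= `|a| * `|b| ;
  norm_cstar : forall a : A, `|amul (adj a) a| = `|a| ^+ 2
}.

#[short(type="cstarAlgType")]
HB.structure Definition CstarAlgebra (R : realType) :=
  {A of isCstarAlgebra R A & CompleteNormedModule R[i] A}.

Section FiniteDimension.
Context {R : realType} {A : cstarAlgType R}.

Definition fin_dim (S : set A) : Prop :=
  exists (n : nat) (e : 'I_n -> A),
    S = [set a | exists c : 'I_n -> R[i], a = \sum_(i < n) c i *: e i].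

Definition cstar_subalgebra (S : set A) : Prop :=
  [/\ S 0,
      forall (k : R[i]) (a b : A), S a -> S b -> S (k *: a + b),
      forall a b : A, S a -> S b -> S (amul a b),
      forall a : A, S a -> S (adj a) &
      closed S].

End FiniteDimension.

Section CompletePositivity.
Context {R : realType}.

(* The *-algebra structure of M_n(A); 'M[A]_n only has MathComp's product when
   A is a unital ring. *)
Definition amulmx (A : cstarAlgType R) (n : nat) (a b : 'M[A]_n) : 'M[A]_n :=
  \matrix_(i, j) \sum_(k < n) amul (a i k) (b k j).

Definition adjmx (A : cstarAlgType R) (n : nat) (a : 'M[A]_n) : 'M[A]_n :=
  \matrix_(i, j) adj (a j i).

Definition posmx (A : cstarAlgType R) (n : nat) (a : 'M[A]_n) : Prop :=
  exists b : 'M[A]_n, a = amulmx (adjmx b) b.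

Definition completely_positive (A B : cstarAlgType R) (f : {linear A -> B}) :
    Prop :=
  forall (n : nat) (a : 'M[A]_n), posmx a -> posmx (map_mx f a).

End CompletePositivity.

Section TraciallyComplete.
Context {R : realType} {M : cstarAlgType R}.

(* The norm of a normed R[i]-module is R[i]-valued, with values in the
   nonnegative reals. *)
Definition rnorm (a : M) : R := complex.Re `|a|.

(* The last clause says that the functional has norm 1. *)
Definition tracial_state (tau : M -> R[i]) : Prop :=
  [/\ scalar tau,
      forall a : M, 0 <= tau (amul (adj a) a),
      forall a b : M, tau (amul a b) = tau (amul b a) &
      ereal_sup [set (complex.Re `|tau a|)%:E | a in [set a | rnorm a <= 1]]
        = 1%:E].

(* The supremum of the empty set is 0. *)
Definition norm2 (X : set (M -> R[i])) (a : M) : R :=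
  sup [set Num.sqrt (complex.Re (tau (amul (adj a) a))) | tau in X].

Definition is_norm (N : M -> R) : Prop :=
  [/\ forall a b : M, N (a + b) <= N a + N b,
      forall (k : R[i]) (a : M), N (k *: a) = complex.Re `|k| * N a &
      forall a : M, N a = 0 -> a = 0].

Definition complete_unit_ball (N : M -> R) : Prop :=
  forall u : nat -> M,
    (forall n, rnorm (u n) <= 1) ->
    (forall eps : R, 0 < eps -> exists n0 : nat, forall m n : nat,
       (n0 <= m)%N -> (n0 <= n)%N -> N (u m - u n) < eps) ->
    exists a : M, rnorm a <= 1 /\
      forall eps : R, 0 < eps -> exists n0 : nat, forall n : nat,
        (n0 <= n)%N -> N (u n - a) < eps.

(* The weak* topology is the topology of pointwise convergence on M. *)
Definition tracially_complete (X : set (M -> R[i])) : Prop :=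
  [/\ X `<=` tracial_state,
      compact (X : set {ptws M -> R[i]^o}),
      convex_set (X : set (M -> R[i]^o)),
      is_norm (norm2 X) &
      complete_unit_ball (norm2 X)].

Definition hyperfinite (X : set (M -> R[i])) : Prop :=
  forall (S : set M) (eps : R), finite_set S -> 0 < eps ->
    exists F : set M, [/\ cstar_subalgebra F, fin_dim F &
      forall a : M, S a -> exists2 b : M, F b & norm2 X (a - b) < eps].

Definition directed (L : Type) (le : L -> L -> Prop) : Prop :=
  [/\ inhabited L,
      forall i, le i i,
      forall i j k, le i j -> le j k -> le i k &
      forall i j, exists k, le i k /\ le j k].

(* The two nets of maps are indexed by the same directed set (L, le). *)
Definition amenable (X : set (M -> R[i])) : Prop :=
  exists (L : Type) (le : L -> L -> Prop) (F : L -> cstarAlgType R)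
         (psi : forall l, {linear M -> F l})
         (phi : forall l, {linear F l -> M}),
    [/\ directed le,
        forall l, fin_dim [set: F l],
        forall l, completely_positive (psi l),
        forall l, completely_positive (phi l) &
        forall (a : M) (eps : R), 0 < eps -> exists l0 : L, forall l : L,
          le l0 l -> norm2 X (phi l (psi l a) - a) < eps].

End TraciallyComplete.

(* Main.v *)
Require Import Defs.
From HB Require Import structures.
From mathcomp Require Import all_boot all_order all_algebra.
From mathcomp Require Import complex.
From mathcomp Require Import all_classical all_reals all_analysis.
From mathcomp Require Import spectral sesquilinear ring lra.

(** Let F be a finite dimensional subalgebra that approximates a finite set in
the norm [norm2 X].  An extension of the identity of F to a completely positive
map from M to F need not be bounded for [norm2 X], but for a single trace tau in
X, faithful on F, the tau-preserving conditional expectation onto F is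
contractive for the 2-norm of tau.  Since [norm2 X] is a norm and F is finite
dimensional, some sigma in X is faithful on F, and averaging with sigma makes
any tau in X faithful at the cost of a factor 2.  Compactness of X leaves
finitely many conditional expectations to consider.  The squared errors are
convex in the map and affine in tau, so by Kneser's minimax argument some convex
combination of these expectations has small error at all tau in X at once.

Complete positivity is obtained from the following criterion: a matrix over a
finite dimensional C*-algebra is of the form b* b as soon as it acts positively
on the Hilbert space given by a faithful positive functional, because the square
root of the representing complex matrix is a polynomial in that matrix. *)

Set Implicit Arguments.
Unset Strict Implicit.
Unset Printing Implicit Defensive.

Import Order.TTheory GRing.Theory Num.Theory.
Import numFieldNormedType.Exports.

Local Open Scope classical_set_scope.
Local Open Scope complex_scope.
Local Open Scope sesquilinear_scope.
Local Open Scope ring_scope.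

(** * Multiplication and involution as linear maps *)

Section CstarLinearity.
Context {R : realType} {A : cstarAlgType R}.
Implicit Types a b c : A.

HB.instance Definition _ a := GRing.isLinear.Build R[i] A A _ (amul a)
  (fun k b c => amulDZr k b c a).

(** The fixed factor comes first, so that right multiplication can carry a linear structure; folding
    [amul] into it lets sums pass through a left factor. *)
Definition ramul b a : A := amul a b.

HB.instance Definition _ b := GRing.isLinear.Build R[i] A A _ (ramul b)
  (fun k a c => amulDZl k a c b).

HB.instance Definition _ := GRing.isLinear.Build R[i] A A
  (Num.conj \; *:%R) adj adjDZ.

End CstarLinearity.

(** * Closed self-adjoint subalgebras as C*-algebras *)

Record cstar_sub (R : realType) (M : cstarAlgType R) := CstarSub {
  sub_set :> set M;
  sub_setP : cstar_subalgebra sub_set }.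

Section CstarSub.
Context {R : realType} {M : cstarAlgType R} (F : cstar_sub M).

Definition sub_pred : {pred M} := [pred x | `[< sub_set F x >]].

Lemma sub_predP x : reflect (sub_set F x) (x \in sub_pred).
Proof. exact: asboolP. Qed.

Lemma sub_pred_submod : submod_closed sub_pred.
Proof.
have [F0 FDZ _ _ _] := sub_setP F; split; first exact/sub_predP.
by move=> k x y /sub_predP Fx /sub_predP Fy; apply/sub_predP/FDZ.
Qed.

HB.instance Definition _ := GRing.isSubmodClosed.Build R[i] M sub_pred
  sub_pred_submod.

(** [amenable] asks for algebras that are types, not subsets. The closure properties bundled in
    [cstar_sub] are what the instances below depend on. *)
Definition sub_alg := {x : M | x \in sub_pred}.

HB.instance Definition _ := [isSub of sub_alg for @sval _ _].
HB.instance Definition _ := [Choice of sub_alg by <:].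
HB.instance Definition _ := [SubChoice_isSubZmodule of sub_alg by <:].
HB.instance Definition _ := [SubZmodule_isSubLmodule of sub_alg by <:].

Let snorm (x : sub_alg) : R[i] := `|val x|.
Let snormD x y : snorm (x + y) <= snorm x + snorm y.
Proof. by rewrite /snorm raddfD ler_normD. Qed.
Let snormZ (k : R[i]) x : snorm (k *: x) = `|k| * snorm x.
Proof. by rewrite /snorm linearZ normrZ. Qed.
Let snorm0_eq0 x : snorm x = 0 -> x = 0.
Proof. by move=> /normr0_eq0 x0; apply/val_inj; rewrite x0 raddf0. Qed.

HB.instance Definition _ := Lmodule_isNormed.Build R[i] sub_alg
  snormD snormZ snorm0_eq0.

Lemma sub_normE (x : sub_alg) : `|x| = `|val x|.
Proof. by []. Qed.

(** The limit exists in M and stays in the subalgebra because the latter is closed. *)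
Lemma sub_alg_cauchy (G : set_system sub_alg) : ProperFilter G -> cauchy G ->
  cvg G.
Proof.
move=> PG /cauchyP Gc.
have PGv : ProperFilter (val @ G) by apply: fmap_proper_filter.
have /cauchy_cvg/cvg_ex [l vl] : cauchy ((val : sub_alg -> M) @ G).
  apply/cauchyP => e e0; have [x Gx] := Gc e e0; exists (val x).
  rewrite /= /fmap /=.
  apply: filterS Gx => y /=; rewrite -!ball_normE /=.
  by rewrite sub_normE raddfB.
have [_ _ _ _ clF] := sub_setP F.
have Fl : sub_set F l.
  apply: (closed_cvg (sub_set F) clF _ l vl).
  by near=> y; apply/sub_predP/(valP y).
pose l' : sub_alg := exist _ l (introT (sub_predP l) Fl).
apply/cvg_ex; exists l'; apply/cvgrPdist_lt => e e0.
move/cvgrPdist_lt: vl => /(_ e e0); apply: filterS => y /=.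
by rewrite sub_normE raddfB.
Unshelve. all: by end_near. Qed.

HB.instance Definition _ := Uniform_isComplete.Build sub_alg sub_alg_cauchy.

Definition smul (x y : sub_alg) : sub_alg.
Proof.
exists (amul (val x) (val y)); have [_ _ FM _ _] := sub_setP F.
by apply/sub_predP/FM; apply/sub_predP/valP.
Defined.

Definition sadj (x : sub_alg) : sub_alg.
Proof.
exists (adj (val x)); have [_ _ _ Fadj _] := sub_setP F.
by apply/sub_predP/Fadj; apply/sub_predP/valP.
Defined.

Let smulA a b c : smul a (smul b c) = smul (smul a b) c.
Proof. by apply/val_inj; rewrite /= amulA. Qed.
Let smulDZl (k : R[i]) a b c : smul (k *: a + b) c = k *: smul a c + smul b c.
Proof. by apply/val_inj; rewrite /= amulDZl. Qed.
Let smulDZr (k : R[i]) a b c : smul c (k *: a + b) = k *: smul c a + smul c b.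
Proof. by apply/val_inj; rewrite /= amulDZr. Qed.
Let sadjDZ (k : R[i]) a b : sadj (k *: a + b) = Num.conj k *: sadj a + sadj b.
Proof. by apply/val_inj; rewrite /= adjDZ. Qed.
Let sadjK a : sadj (sadj a) = a.
Proof. by apply/val_inj; rewrite /= adjK. Qed.
Let sadjM a b : sadj (smul a b) = smul (sadj b) (sadj a).
Proof. by apply/val_inj; rewrite /= adjM. Qed.
Let snorm_mul a b : `|smul a b| <= `|a| * `|b|.
Proof. exact: norm_amul. Qed.
Let snorm_cstar a : `|smul (sadj a) a| = `|a| ^+ 2.
Proof. exact: norm_cstar. Qed.

HB.instance Definition _ := isCstarAlgebra.Build R sub_alg smulA smulDZl smulDZr
  sadjDZ sadjK sadjM snorm_mul snorm_cstar.

Definition sub_val (x : sub_alg) : M := val x.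

Lemma sub_val_linear : linear sub_val.
Proof. by []. Qed.

HB.instance Definition _ := GRing.isLinear.Build R[i] sub_alg M _ sub_val
  sub_val_linear.

Lemma sub_valM x y : sub_val (amul x y) = amul (sub_val x) (sub_val y).
Proof. by []. Qed.

Lemma sub_val_adj x : sub_val (adj x) = adj (sub_val x).
Proof. by []. Qed.

Lemma sub_val_cp : completely_positive sub_val.
Proof.
move=> n _ [b ->]; exists (map_mx sub_val b); apply/matrixP => i j.
by rewrite !mxE raddf_sum; apply: eq_bigr => k _; rewrite !mxE.
Qed.

Lemma sub_val_surj a : sub_set F a -> exists b, sub_val b = a.
Proof. by move=> /sub_predP Fa; exists (exist _ a Fa). Qed.

Lemma sub_fin_dim : fin_dim (sub_set F) -> fin_dim [set: sub_alg].
Proof.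
case=> n [e Fe].
have Fei i : sub_set F (e i).
  rewrite Fe; exists (fun j => (i == j)%:R); rewrite (bigD1 i) //= eqxx scale1r.
  by rewrite big1 ?addr0 // => j; rewrite eq_sym => /negPf ->; rewrite scale0r.
have /choice[e' e'E] i := sub_val_surj (Fei i).
exists n, e'; apply/seteqP; split=> // x _.
have := elimT (sub_predP _) (valP x); rewrite {1}Fe => -[c xE]; exists c.
apply/val_inj; rewrite [val x]xE (raddf_sum sub_val).
by apply: eq_bigr => i _; rewrite -e'E.
Qed.

End CstarSub.

(** * Positive sesquilinear forms and Gram-Schmidt *)

Section PositiveForm.
Context {C : numClosedFieldType} {V : lmodType C} (f : V -> V -> C).
Hypothesis fDZr : forall k x y z, f x (k *: y + z) = k * f x y + f x z.
Hypothesis fDZl : forall k x y z, f (k *: x + y) z = k^* * f x z + f y z.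
Hypothesis f_ge0 : forall x, 0 <= f x x.

(** Polarization: the form is real at y + x and at iy + x, and comparing these values with their
    conjugates determines the sum and the difference of [f x y] and [f y x]. *)
Lemma form_conj x y : f y x = (f x y)^*.
Proof.
have fr z : (f z z)^* = f z z by apply/conj_Creal/ger0_real.
have := fr (1 *: y + x); have := fr ('i *: y + x).
rewrite !(fDZr, fDZl) !(rmorphD, rmorphM) /= ?conjCK !fr.
rewrite ?rmorph1 ?conjCi ?rmorphN /= ?conjCi ?opprK ?rmorph1.
have i0 : 'i != 0 :> C by exact: neq0Ci.
have ii : 'i * 'i = -1 :> C by exact: mulCii.
have two0 : 2 != 0 :> C by rewrite pnatr_eq0.
move: (f x y) (f x y)^* (f y x) (f y x)^* => a a' b b' h1 h2.
have h3 : 'i * (b' - a') = 'i * (a - b).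
  apply: (addrI (- ('i * 'i) * f y y + f x x)).
  transitivity (- 'i * ('i * f y y + a') + ('i * b' + f x x)); first by ring.
  by rewrite h1; ring.
have h4 : a' + b' = a + b.
  apply: (addrI (f y y + f x x)).
  transitivity (1 * (1 * f y y + a') + (1 * b' + f x x)); first by ring.
  by rewrite h2; ring.
apply: (mulfI two0).
transitivity (a + b - (a - b)); first by ring.
by rewrite -(mulfI i0 h3) -h4; ring.
Qed.

Let fr_lin x : linear_for *%R (f x).
Proof. by move=> k y z; rewrite fDZr. Qed.
HB.instance Definition _ x := GRing.isLinear.Build C V C *%R (f x) (fr_lin x).

Lemma form0l z : f 0 z = 0.
Proof. by rewrite form_conj raddf0 rmorph0. Qed.

Lemma formZl k x z : f (k *: x) z = k^* * f x z.
Proof. by rewrite -[k *: x]addr0 fDZl form0l addr0. Qed.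

Lemma formZr k x z : f z (k *: x) = k * f z x.
Proof. by rewrite linearZ. Qed.

Lemma form_combination k l x y :
  f (k *: x + l *: y) (k *: x + l *: y) =
  k^* * k * f x x + k^* * l * f x y + l^* * k * f y x + l^* * l * f y y.
Proof. by rewrite !(fDZr, fDZl, formZl, formZr); ring. Qed.

Lemma form_parallelogram x y :
  f (x + y) (x + y) + f (x - y) (x - y) = 2 * f x x + 2 * f y y.
Proof.
have := form_combination 1 1 x y; have := form_combination 1 (-1) x y.
by rewrite !scale1r scaleN1r rmorphN !rmorph1 => -> ->; ring.
Qed.

(** For t in [0, 1] the subtracted term is nonnegative, so this identity yields the convexity of the
    squared seminorm. *)
Lemma form_convex (t : C) x y : t^* = t ->
  f (t *: x + (1 - t) *: y) (t *: x + (1 - t) *: y) =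
  t * f x x + (1 - t) * f y y - t * (1 - t) * f (x - y) (x - y).
Proof.
move=> tr; have := form_combination 1 (-1) x y.
rewrite scale1r scaleN1r rmorphN rmorph1 => ->.
by rewrite form_combination rmorphB rmorph1 /= tr; ring.
Qed.

(* Gram-Schmidt: the elements of [us] need not be independent or pairwise
   orthogonal, only the reproducing formula matters. *)
Lemma frame_exists (es : seq V) : (forall x, f x x = 0 -> x = 0) ->
  exists us : seq V, forall x, x \in es -> x = \sum_(u <- us) f u x *: u.
Proof.
move=> fdef.
(* The induction also needs that [us] reproduces its own members: then P below is the orthogonal
   projection onto their span. *)
suff [us [Hes _]] : exists us : seq V,
    (forall x, x \in es -> x = \sum_(u <- us) f u x *: u) /\
    (forall x, x \in us -> x = \sum_(u <- us) f u x *: u) by exists us.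
elim: es => [|e es [us [IHe IHu]]]; first by exists [::].
pose P x := \sum_(u <- us) f u x *: u.
have Psym x y : f x (P y) = f (P x) y.
  rewrite [RHS]form_conj !linear_sum rmorph_sum; apply: eq_bigr => u _ /=.
  by rewrite !linearZ /= rmorphM /= -!form_conj mulrC.
have [w0|wn0] := eqVneq (e - P e) 0.
  exists us; split=> // x; rewrite inE => /predU1P[->|/IHe//].
  by apply/eqP; rewrite -subr_eq0; apply/eqP.
pose w := e - P e.
have uw u : u \in us -> f u w = 0.
  by move=> uus; rewrite linearB /= Psym (_ : P u = u) ?subrr //; exact/esym/IHu.
have ww : 0 < f w w.
  by rewrite lt_neqAle f_ge0 andbT eq_sym; apply: contra_neq wn0; apply: fdef.
pose k := (sqrtC (f w w))^-1; pose w' := k *: w.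
have kr : k^* = k.
  by rewrite fmorphV /= conj_Creal // ger0_real // sqrtC_ge0 ltW.
have fZl z : f w' z = k * f w z by rewrite formZl kr.
have w'w' : f w' w' = 1.
  rewrite fZl linearZ /= mulrA -expr2 exprVn sqrtCK mulVf // gt_eqF //.
have P'u x : x \in us -> x = \sum_(u <- w' :: us) f u x *: u.
  move=> xus; rewrite big_cons -IHu // fZl form_conj uw // rmorph0.
  by rewrite mulr0 scale0r add0r.
have P'w : w' = \sum_(u <- w' :: us) f u w' *: u.
  rewrite big_cons w'w' scale1r big_seq big1 ?addr0 // => u /uw uw0.
  by rewrite linearZ /= uw0 mulr0 scale0r.
have PL x : x \in w' :: us -> x = \sum_(u <- w' :: us) f u x *: u.
  by rewrite inE => /predU1P[->|/P'u].
(* The vectors reproduced by the enlarged family form a subspace containing w' and the range of P,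
   hence e and all earlier vectors. *)
pose fixed x := x = \sum_(u <- w' :: us) f u x *: u.
have fixedDZ a x y : fixed x -> fixed y -> fixed (a *: x + y).
  rewrite /fixed => hx hy; rewrite {1}hx {1}hy scaler_sumr -big_split /=.
  by apply: eq_bigr => u _; rewrite fDZr scalerDl scalerA.
have fixed0 : fixed 0.
  by rewrite /fixed big1 // => u _; rewrite raddf0 scale0r.
have fixedP x : fixed (P x).
  rewrite /P big_seq; elim/big_ind: _ => [//|y z hy hz|u uus].
    by rewrite -[y]scale1r; apply: fixedDZ.
  by rewrite -[_ *: u]addr0; apply: fixedDZ => //; apply: PL; rewrite inE uus orbT.
have fixed_e : fixed e.
  have -> : e = k^-1 *: w' + P e.
    by rewrite scalerA mulVf ?scale1r ?subrK // invr_eq0 sqrtC_eq0 gt_eqF.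
  by apply: fixedDZ => //; apply: PL; rewrite inE eqxx.
exists (w' :: us); split; last exact: PL.
move=> x; rewrite inE => /predU1P[->//|/IHe xE].
by have := fixedP x; rewrite /fixed -[P x]xE.
Qed.
End PositiveForm.

(** * Square roots of positive semidefinite matrices *)

Section MatrixSquareRoot.
Context {C : numClosedFieldType}.

Lemma interpolation (s : seq C) (g : C -> C) :
  exists p : {poly C}, forall x, x \in s -> p.[x] = g x.
Proof.
elim: s => [|x s [p pE]]; first by exists 0.
have [xs|xs] := boolP (x \in s).
  by exists p => y; rewrite inE => /predU1P[->|]; apply: pE.
pose q := \prod_(y <- s) ('X - y%:P).
have qx : q.[x] != 0 by rewrite -/(root q x) root_prod_XsubC.
exists (p + ((g x - p.[x]) / q.[x]) *: q) => y.
rewrite hornerD hornerZ inE => /predU1P[->|ys].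
  by rewrite divfK // addrC subrK.
suff /rootP -> : root q y by rewrite mulr0 addr0 pE.
by rewrite root_prod_XsubC.
Qed.

Definition psdmx n (A : 'M[C]_n) :=
  forall v : 'rV[C]_n, 0 <= (v *m A *m v^t*) 0 0.

(** Nonnegative elements of C are real, so A defines a positive form; its conjugate symmetry is read
    off at the basis vectors. *)
Lemma psdmx_hermitian n (A : 'M[C]_n) : psdmx A -> A^t* = A.
Proof.
move=> Apos; apply/matrixP => i j; rewrite !mxE.
pose f (v w : 'rV[C]_n) := (w *m A *m v^t*) 0 0.
have fE k l : f (delta_mx 0 k) (delta_mx 0 l) = A l k.
  rewrite /f -rowE mxE (bigD1 k) //= !mxE !eqxx /= rmorph1 mulr1 big1 ?addr0 //.
  by move=> m /negPf mk; rewrite !mxE mk andbF /= rmorph0 mulr0.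
rewrite -!fE -(@form_conj _ _ f) //.
- by move=> k x y z; rewrite /f mulmxDl -scalemxAl mulmxDl -scalemxAl !mxE.
- move=> k x y z; rewrite /f linearD linearZ /= map_mxD map_mxZ mulmxDr.
  by rewrite -scalemxAr !mxE.
Qed.

(* The square root of [A] is a polynomial in [A] without constant term, hence
   it stays in any subalgebra, unital or not. *)
Lemma psdmx_sqrt n (A : 'M[C]_n) (S : 'M[C]_n -> Prop) :
  S 0 -> (forall k B D, S B -> S D -> S (k *: B + D)) ->
  (forall B D, S B -> S D -> S (B *m D)) -> S A -> psdmx A ->
  exists2 B, S B & B^t* *m B = A.
Proof.
move=> S0 SDZ SM SA Apos.
have /orthomx_spectralP AE : A \is normalmx.
  by apply/normalmxP; rewrite psdmx_hermitian.
set P := spectralmx A in AE; set d := spectral_diag A in AE.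
have Pu : P \is unitarymx by apply: spectral_unitarymx.
have PP : P *m P^t* = 1%:M by apply/unitarymxP.
rewrite invmx_unitary // in AE.
have d_ge0 i : 0 <= d 0 i.
  have := Apos (row i P); rewrite rowE trmx_mul map_mxM /= !mulmxA.
  rewrite -[_ *m P *m A]mulmxA -[_ *m (P *m A) *m _]mulmxA.
  rewrite (_ : P *m A *m P^t* = diag_mx d); last first.
    by rewrite {1}AE !mulmxA PP mul1mx -mulmxA PP mulmx1.
  rewrite -rowE row_diag_mx -scalemxAl mxE -rowE !mxE !eqxx /=.
  by rewrite rmorph1 mulr1.
(* Functional calculus: the matrix with eigenvalues e in the eigenbasis of A. *)
pose diagP (e : 'rV[C]_n) := P^t* *m diag_mx e *m P.
have diagPM e1 e2 : diagP e1 *m diagP e2 = diagP (\row_i (e1 0 i * e2 0 i)).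
  rewrite /diagP !mulmxA -[_ *m P *m _]mulmxA PP mulmx1 -[_ *m diag_mx e1 *m _]mulmxA.
  by rewrite mulmx_diag.
have Spoly p : S (diagP (\row_i (p.[d 0 i] * d 0 i))).
  elim/poly_ind: p => [|p c IH].
    rewrite (_ : \row__ _ = 0) ?/diagP ?linear0 ?mulmx0 ?mul0mx //.
    by apply/rowP => i; rewrite !mxE horner0 mul0r.
  rewrite (_ : \row__ _ = c *: d + \row_i ((\row_i (p.[d 0 i] * d 0 i)) 0 i * d 0 i)).
    rewrite /diagP linearD linearZ /= mulmxDr mulmxDl -scalemxAr -scalemxAl -AE.
    by apply: SDZ => //; rewrite -/(diagP _) -diagPM {2}/diagP -AE; apply: SM.
  by apply/rowP => i; rewrite !mxE !hornerE; ring.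
(* At a nonzero eigenvalue x this gives p(x) x = sqrt x, and at 0 both sides are 0. Hence the square
   root of A is p(A) A, which lies in S by [Spoly]. *)
have [p pE] := interpolation [seq d 0 i | i : 'I_n] (fun x => (sqrtC x)^-1).
exists (diagP (\row_i sqrtC (d 0 i))).
  rewrite (_ : \row__ _ = \row_i (p.[d 0 i] * d 0 i)) //.
  apply/rowP => i; rewrite !mxE pE ?map_f ?mem_enum //.
  have [->|d0] := eqVneq (d 0 i) 0; first by rewrite sqrtC0 mulr0.
  by rewrite -{3}[d 0 i]sqrtCK expr2 mulKf // sqrtC_eq0.
have -> : (diagP (\row_i sqrtC (d 0 i)))^t* = diagP (\row_i sqrtC (d 0 i)).
  rewrite /diagP !trmx_mul !map_mxM /= trmxCK tr_diag_mx map_diag_mx mulmxA.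
  congr (_ *m diag_mx _ *m _); apply/rowP => i; rewrite !mxE.
  by rewrite /= conj_Creal // ger0_real // sqrtC_ge0.
rewrite diagPM AE; congr (_ *m diag_mx _ *m _); apply/rowP => i.
by rewrite !mxE -expr2 sqrtCK.
Qed.

End MatrixSquareRoot.

(** * The inner product of a positive functional *)

Section PositiveFunctional.
Context {R : realType} {A : cstarAlgType R} (tau : {scalar A}).
Hypothesis tau_ge0 : forall a, 0 <= tau (amul (adj a) a).

Definition gns (a b : A) := tau (amul (adj a) b).

Lemma gnsDZr k a b c : gns a (k *: b + c) = k * gns a b + gns a c.
Proof. by rewrite /gns !linearP. Qed.

Lemma gnsDZl k a b c : gns (k *: a + b) c = k^* * gns a c + gns b c.
Proof. by rewrite /gns adjDZ amulDZl linearP. Qed.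

Lemma gnsMl a b c : gns a (amul b c) = gns (amul (adj b) a) c.
Proof. by rewrite /gns adjM adjK amulA. Qed.

HB.instance Definition _ a := GRing.isLinear.Build R[i] A R[i] *%R (gns a)
  (fun k b c => gnsDZr k a b c).

Lemma gnsZr k a b : gns a (k *: b) = k * gns a b.
Proof. by rewrite linearZ. Qed.

Lemma gns_conj a b : gns b a = (gns a b)^*.
Proof. exact: (form_conj gnsDZr gnsDZl). Qed.

Lemma gns_suml (I : finType) (c : I -> R[i]) (a : I -> A) b :
  gns (\sum_i c i *: a i) b = \sum_i (c i)^* * gns (a i) b.
Proof.
rewrite gns_conj linear_sum rmorph_sum; apply: eq_bigr => i _ /=.
by rewrite linearZ rmorphM /= -gns_conj.
Qed.

Hypothesis tau_def : forall a, tau (amul (adj a) a) = 0 -> a = 0.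
Hypothesis A_fin_dim : fin_dim [set: A].

Lemma gns_frame : exists (m : nat) (u : 'I_m -> A),
  forall a, a = \sum_i gns (u i) a *: u i.
Proof.
have [n [e eE]] := A_fin_dim.
have [us usE] := frame_exists gnsDZr gnsDZl tau_ge0 [seq e i | i : 'I_n] tau_def.
exists (size us), (fun i => us`_i) => a.
have [c ->] : [set a | exists c : 'I_n -> R[i], a = \sum_(i < n) c i *: e i] a.
  by rewrite -eE.
have {}usE i : e i = \sum_(j < size us) gns us`_j (e i) *: us`_j.
  by rewrite {1}(usE (e i)) ?map_f ?mem_enum // (big_nth 0) big_mkord.
rewrite {1}(eq_bigr _ (fun i _ => congr1 ( *:%R (c i)) (usE i))).
rewrite (eq_bigr _ (fun i _ => scaler_sumr _ _ _ _)) exchange_big /=.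
apply: eq_bigr => j _; rewrite linear_sum scaler_suml.
by apply: eq_bigr => i _; rewrite /= gnsZr scalerA.
Qed.

End PositiveFunctional.

(** * A criterion for positivity of matrices over a finite dimensional algebra *)

Section PositivityCriterion.
Context {R : realType} {A : cstarAlgType R} (tau : {scalar A}).
Hypothesis tau_ge0 : forall a, 0 <= tau (amul (adj a) a).
Context (m : nat) (u : 'I_m -> A).
Hypothesis uE : forall a, a = \sum_i gns tau (u i) a *: u i.
Context {n : nat}.
Implicit Types (h g : 'M[A]_n) (s t : 'I_#|{: 'I_n * 'I_m}|).

(* The matrix of the left multiplication by [h] on the Hilbert space of
   n-tuples of elements of A. *)
Definition left_rep h : 'M[R[i]]_#|{: 'I_n * 'I_m}| :=
  \matrix_(s, t) gns tau (u (enum_val s).2)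
                     (amul (h (enum_val s).1 (enum_val t).1) (u (enum_val t).2)).

Lemma sum_enum_val2 (F : 'I_n -> 'I_m -> R[i]) :
  \sum_(t < #|{: 'I_n * 'I_m}|) F (enum_val t).1 (enum_val t).2 = \sum_p \sum_i F p i.
Proof.
rewrite pair_big /= -(big_enum_val (A := {: 'I_n * 'I_m}) (fun k => F k.1 k.2)).
by apply: eq_bigl => k; rewrite inE.
Qed.

Lemma left_repM h g : left_rep (amulmx h g) = left_rep h *m left_rep g.
Proof.
apply/matrixP => s t; rewrite !mxE.
under [RHS]eq_bigr => r _ do rewrite !mxE.
move: (enum_val s) (enum_val t) => [p i] [q j] /=.
rewrite (sum_enum_val2 (fun r k => gns tau (u i) (amul (h p r) (u k)) *
  gns tau (u k) (amul (g r q) (u j)))).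
rewrite -[amul (\sum_k _) _]/(ramul (u j) _) !raddf_sum /=; apply: eq_bigr => r _.
rewrite /ramul -amulA {1}(uE (amul (g r q) (u j))) !linear_sum /=.
by apply: eq_bigr => k _; rewrite !linearZ /= mulrC.
Qed.

Lemma left_rep_adj h : left_rep (adjmx h) = (left_rep h)^t*.
Proof.
apply/matrixP => s t; rewrite !mxE -gns_conj //.
by rewrite gnsMl adjK.
Qed.

Lemma left_rep0 : left_rep 0 = 0.
Proof.
by apply/matrixP => s t; rewrite !mxE -[amul 0 _]/(ramul _ 0) !raddf0.
Qed.

Lemma left_repDZ k h g :
  left_rep (map_mx ( *:%R k) h + g) = k *: left_rep h + left_rep g.
Proof. by apply/matrixP => s t; rewrite !mxE amulDZl gnsDZr. Qed.

(** An entry d of the difference annihilates every [u j], hence also [adj d], which is a combination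
    of them; the C*-identity then gives d = 0 without recourse to a unit. *)
Lemma left_rep_inj : injective left_rep.
Proof.
move=> h g /matrixP E; apply/matrixP => p q.
apply/eqP; rewrite -subr_eq0; set d := _ - _.
have du j : amul d (u j) = 0.
  rewrite [LHS]uE big1 // => i _.
  have := E (enum_rank (p, i)) (enum_rank (q, j)); rewrite !mxE !enum_rankK /=.
  rewrite /d -[amul (_ - _) _]/(ramul _ _) raddfB /= raddfB /= => ->.
  by rewrite subrr scale0r.
have : `|adj d| ^+ 2 = 0.
  rewrite -norm_cstar adjK [in amul _ _](uE (adj d)) linear_sum big1 ?normr0 // => i _.
  by rewrite linearZ /= du scaler0.
move/eqP; rewrite expf_eq0 /= normr_eq0 => /eqP d0.
by rewrite -[d]adjK d0 raddf0.
Qed.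

Lemma left_rep_psd h :
  (forall y : 'I_n -> A,
     0 <= \sum_p \sum_q gns tau (y p) (amul (h p q) (y q))) ->
  psdmx (left_rep h).
Proof.
move=> hpos v; pose c p i := v 0 (enum_rank (p, i)).
have cE s : c (enum_val s).1 (enum_val s).2 = v 0 s.
  by rewrite /c -surjective_pairing enum_valK.
(* [psdmx] evaluates v A v^*, with the conjugate on the right, so the tuple to test has the
   conjugates of v as coordinates. *)
have := hpos (fun p => \sum_i (c p i)^* *: u i); congr (0 <= _).
rewrite -mulmxA !mxE.
transitivity (\sum_p \sum_i c p i * \sum_q \sum_j
    gns tau (u i) (amul (h p q) (u j)) * (c q j)^*).
  apply: eq_bigr => p _; under [RHS]eq_bigr => i _ do rewrite mulr_sumr.
  rewrite exchange_big; apply: eq_bigr => q _ /=.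
  rewrite gns_suml //; apply: eq_bigr => i _; rewrite conjCK; congr (_ * _).
  rewrite !linear_sum; apply: eq_bigr => j _ /=.
  by rewrite linearZ /= gnsZr mulrC.
rewrite -(sum_enum_val2 (fun p i => c p i * \sum_q \sum_j
  gns tau (u i) (amul (h p q) (u j)) * (c q j)^*)).
apply: eq_bigr => s _; rewrite cE !mxE; congr (_ * _).
rewrite -(sum_enum_val2 (fun q j =>
  gns tau (u (enum_val s).2) (amul (h (enum_val s).1 q) (u j)) * (c q j)^*)).
by apply: eq_bigr => t _; rewrite cE !mxE.
Qed.

(** The range of [left_rep] is closed under sums and products, so it contains a square root of the
    matrix of h; injectivity pulls the factorization back to A. *)
Lemma posmx_of_ge0 h :
  (forall y : 'I_n -> A,
     0 <= \sum_p \sum_q gns tau (y p) (amul (h p q) (y q))) ->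
  posmx h.
Proof.
move=> /left_rep_psd hpsd.
have [| | |B [b <-]] := @psdmx_sqrt _ _ (left_rep h)
    (fun B => exists b, left_rep b = B) _ _ _ (ex_intro _ h erefl) hpsd.
- by exists 0; apply: left_rep0.
- move=> k _ _ [b <-] [d <-]; exists (map_mx ( *:%R k) b + d).
  exact: left_repDZ.
- by move=> _ _ [b <-] [d <-]; exists (amulmx b d); apply: left_repM.
by rewrite -left_rep_adj -left_repM => /left_rep_inj <-; exists b.
Qed.

End PositivityCriterion.

(** For h = b* b the double sum is the sum of the squared seminorms of the entries of b y. *)
Lemma posmx_ge0 (R : realType) (A : cstarAlgType R) (tau : {scalar A})
    (n : nat) (h : 'M[A]_n) (y : 'I_n -> A) :
  (forall a, 0 <= tau (amul (adj a) a)) -> posmx h ->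
  0 <= \sum_p \sum_q gns tau (y p) (amul (h p q) (y q)).
Proof.
move=> tau_ge0 [b ->].
rewrite (_ : \sum_p _ =
  \sum_k gns tau (\sum_p amul (b k p) (y p)) (\sum_q amul (b k q) (y q))).
  by apply: sumr_ge0 => k _; apply: tau_ge0.
transitivity (\sum_p \sum_q \sum_k
    gns tau (amul (b k p) (y p)) (amul (b k q) (y q))).
  apply: eq_bigr => p _; apply: eq_bigr => q _; rewrite mxE.
  rewrite -[amul (\sum_k _) _]/(ramul _ _) !raddf_sum; apply: eq_bigr => k _.
  by rewrite /= /ramul mxE -amulA gnsMl adjK.
under eq_bigr => p _ do rewrite exchange_big.
rewrite exchange_big; apply: eq_bigr => k _ /=.
rewrite [RHS]/gns (raddf_sum adj) -[amul (\sum_p _) _]/(ramul _ _) !raddf_sum.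
apply: eq_bigr => p _; rewrite /= /ramul. by rewrite -(raddf_sum (gns tau _)).
Qed.

(** * The trace-preserving conditional expectation *)

Section ConditionalExpectation.
Context {R : realType} {M : cstarAlgType R} (F : cstar_sub M).
Local Notation A := (sub_alg F).
Context (tau : {scalar M}).
Hypothesis tau_ge0 : forall a, 0 <= tau (amul (adj a) a).
Hypothesis tau_trace : forall a b, tau (amul a b) = tau (amul b a).

Definition sub_tau : {scalar A} := tau \o sub_val (F := F).

Lemma gns_sub (a b : A) : gns sub_tau a b = gns tau (sub_val a) (sub_val b).
Proof. by []. Qed.

Context (m : nat) (u : 'I_m -> A).
Hypothesis uE : forall a, a = \sum_i gns sub_tau (u i) a *: u i.

(** By the reproducing formula for [u], this is the orthogonal projection onto the subalgebra for
    the inner product of [tau]. *)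
Definition cond_exp (x : M) : A := \sum_i gns tau (sub_val (u i)) x *: u i.

Lemma cond_exp_linear : linear cond_exp.
Proof.
move=> k x y; rewrite /cond_exp scaler_sumr -big_split /=.
by apply: eq_bigr => i _; rewrite gnsDZr scalerDl scalerA.
Qed.

HB.instance Definition _ := GRing.isLinear.Build R[i] M A _ cond_exp
  cond_exp_linear.

Lemma cond_exp_id (a : A) : cond_exp (sub_val a) = a.
Proof. by rewrite [RHS]uE. Qed.

Lemma gns_cond_exp (y : A) x :
  gns tau (sub_val y) (sub_val (cond_exp x)) = gns tau (sub_val y) x.
Proof.
rewrite {2}(uE y) !linear_sum /= gns_suml //; apply: eq_bigr => i _.
by rewrite gnsZr -gns_conj // mulrC.
Qed.

(** The trace property rewrites tau(y_p^* z y_q) as the inner product of z with y_p y_q^*, an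
    element of the subalgebra. Such a product is the same for x and for its projection, so
    positivity passes from x to [cond_exp x]. *)
Lemma cond_exp_cp : completely_positive cond_exp.
Proof.
move=> n x xpos; apply: (posmx_of_ge0 (tau := sub_tau) _ uE) => [a|y].
  exact: tau_ge0.
have := posmx_ge0 (fun p => sub_val (y p)) tau_ge0 xpos; congr (0 <= _).
apply: eq_bigr => p _; apply: eq_bigr => q _; rewrite mxE gns_sub sub_valM.
have rot z : gns tau (sub_val (y p)) (amul z (sub_val (y q))) =
    gns tau (sub_val (amul (y p) (adj (y q)))) z.
  by rewrite /gns sub_valM sub_val_adj adjM adjK amulA tau_trace amulA.
by rewrite !rot gns_cond_exp.
Qed.

(** Pythagoras: the difference of the two sides is the squared seminorm of x - e. *)
Lemma cond_exp_contractive x :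
  gns tau (sub_val (cond_exp x)) (sub_val (cond_exp x)) <= gns tau x x.
Proof.
set e := sub_val (cond_exp x).
have ex : gns tau e x = gns tau e e by rewrite /e gns_cond_exp.
have xe : gns tau x e = gns tau e e.
  rewrite gns_conj // ex conj_Creal // ger0_real //; exact: tau_ge0.
have := form_combination (gnsDZr tau) (gnsDZl tau) tau_ge0 1 (-1) x e.
rewrite rmorphN rmorph1 ex xe => h; rewrite -subr_ge0.
have : 0 <= gns tau (1 *: x + -1 *: e) (1 *: x + -1 *: e) by exact: tau_ge0.
by rewrite h; congr (0 <= _); ring.
Qed.

End ConditionalExpectation.

(** [posmx] asks for a single factorization b* b, which a sum of two such matrices does not display;
    the criterion reduces the claim to a sum of nonnegative numbers. *)
Lemma completely_positive_combination (R : realType) (A B : cstarAlgType R)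
    (tau : {scalar B}) (f g : {linear A -> B}) (k l : R[i]) :
  (forall b, 0 <= tau (amul (adj b) b)) ->
  (forall b, tau (amul (adj b) b) = 0 -> b = 0) -> fin_dim [set: B] ->
  0 <= k -> 0 <= l -> completely_positive f -> completely_positive g ->
  completely_positive (k \*: f \+ l \*: g)%R.
Proof.
move=> tau_ge0 tau_def fdB k0 l0 fcp gcp n a apos.
have [m [u uE]] := gns_frame tau_ge0 tau_def fdB.
apply: (posmx_of_ge0 tau_ge0 uE) => y.
have fpos := posmx_ge0 y tau_ge0 (fcp n a apos).
have gpos := posmx_ge0 y tau_ge0 (gcp n a apos).
have := addr_ge0 (mulr_ge0 k0 fpos) (mulr_ge0 l0 gpos); congr (0 <= _).
rewrite !mulr_sumr -big_split; apply: eq_bigr => p _ /=.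
rewrite !mulr_sumr -big_split; apply: eq_bigr => q _ /=.
rewrite !mxE /= amulDZl gnsDZr; congr (_ + _).
by rewrite -[amul (_ *: _) _]/(ramul _ _) linearZ gnsZr.
Qed.

(** * Kneser's minimax argument *)

Section Minimax.
Context {R : realType} {T : Type} (mix : R -> T -> T -> T).

Let affine_on (X : set T) (g : T -> R) := forall t x y,
  0 <= t <= 1 -> X x -> X y -> g (mix t x y) = t * g x + (1 - t) * g y.

Let mix_closed (X : set T) := forall t x y,
  0 <= t <= 1 -> X x -> X y -> X (mix t x y).

(* The image of [X] under [(g, h)] is a convex subset of the plane that misses
   the open positive quadrant; the weight is the slope of a separating line. *)
Lemma minimax2 (X : set T) (g h : T -> R) :
  mix_closed X -> affine_on X g -> affine_on X h ->
  (forall x, X x -> g x <= 0 \/ h x <= 0) ->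
  exists2 t, 0 <= t <= 1 & forall x, X x -> t * g x + (1 - t) * h x <= 0.
Proof.
move=> Xc ga ha Xgh.
(* A point y with [h y > 0] imposes the lower bound h y / (h y - g y) on the weight t; the element 0
   ensures t >= 0. *)
pose L := [set l | l = 0 \/ exists y, [/\ X y, 0 < h y & l = h y / (h y - g y)]].
(* With denominators cleared: the lower bound imposed by y does not exceed the upper bound - h x /
   (g x - h x) imposed by x. Otherwise some mixture of x and y would make g and h both positive. *)
have crossing x y : X x -> X y -> 0 < g x -> 0 < h y -> g x * h y <= h x * g y.
  move=> Xx Xy gx hy; rewrite leNgt; apply/negP => lt_gh.
  have hx : h x <= 0 by case: (Xgh x Xx) => //; rewrite leNgt gx.
  have gy : g y <= 0 by case: (Xgh y Xy) => //; rewrite [h y <= 0]leNgt hy.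
  (* With this e and the r below, both r g x + g y and g x (r h x + h y) equal e. *)
  pose e := (g x * h y - h x * g y) / (1 - h x).
  have e0 : 0 < e by rewrite divr_gt0; lra.
  have eE : e * (1 - h x) = g x * h y - h x * g y by rewrite divfK // gt_eqF; lra.
  pose r := (e - g y) / g x.
  have rE : r * g x = e - g y by rewrite divfK // gt_eqF.
  have r0 : 0 < r by rewrite divr_gt0; lra.
  have rg : 0 < r * g x + g y by rewrite rE; lra.
  have rh : 0 < r * h x + h y.
    by rewrite -(pmulr_rgt0 _ gx); move: rE eE e0; nra.
  have t01 : 0 <= r / (1 + r) <= 1.
    by apply/andP; split; [rewrite divr_ge0; lra|rewrite ler_pdivrMr; lra].
  have tE z w : r / (1 + r) * z + (1 - r / (1 + r)) * w = (r * z + w) / (1 + r).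
    by field; lra.
  have r1 : 0 < (1 + r)^-1 by rewrite invr_gt0; lra.
  have [] := Xgh _ (Xc _ _ _ t01 Xx Xy); rewrite (ga, ha) // tE.
    by rewrite leNgt mulr_gt0.
  by rewrite leNgt mulr_gt0.
have Lge0 : L 0 by left.
have gy_le0 y : X y -> 0 < h y -> g y <= 0.
  by move=> Xy hy; case: (Xgh y Xy) => //; rewrite leNgt hy.
have Lub : ubound L 1.
  move=> _ [->//|[y [Xy hy ->]]]; have gy := gy_le0 y Xy hy.
  by rewrite ler_pdivrMr; lra.
have hasL : has_sup L by split; [exists 0|exists 1].
exists (sup L).
  by rewrite (ub_le_sup hasL.2 Lge0) (ge_sup hasL.1 Lub).
move=> x Xx; set t := sup L.
have [gx|gx] := leP (g x) 0; last first.
  have hx : h x <= 0 by case: (Xgh x Xx) => //; rewrite leNgt gx.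
  have : t <= - h x / (g x - h x).
    apply: (ge_sup hasL.1) => _ [->|[y [Xy hy ->]]].
      by rewrite divr_ge0; lra.
    have := crossing x y Xx Xy gx hy; have := gy_le0 y Xy hy => gy c.
    rewrite ler_pdivrMr; last lra.
    rewrite mulrAC ler_pdivlMr; [nra|lra].
  by rewrite ler_pdivlMr; lra.
have t0 : 0 <= t by exact: (ub_le_sup hasL.2 Lge0).
have t1 : t <= 1 by exact: (ge_sup hasL.1 Lub).
have [hx|hx] := leP (h x) 0; first by nra.
have : h x / (h x - g x) <= t by apply: (ub_le_sup hasL.2); right; exists x.
by rewrite ler_pdivrMr; lra.
Qed.

(** Induction on s: the points where [p i] fails form a convex set, on which some q from the
    induction hypothesis works. At each point of X one of q and [p i] is good, so [minimax2]
    supplies a weight, and convexity in the map bounds the combination. *)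
Lemma kneser_minimax (P : Type) (S : set P) (conv : R -> P -> P -> P)
    (f : P -> T -> R) (I : eqType) (p : I -> P) (s : seq I) (X : set T) :
  (forall t q r, 0 <= t <= 1 -> S q -> S r -> S (conv t q r)) ->
  (forall t q r x, 0 <= t <= 1 -> S q -> S r -> X x ->
     f (conv t q r) x <= t * f q x + (1 - t) * f r x) ->
  (forall q, S q -> affine_on X (f q)) -> mix_closed X ->
  (forall i, S (p i)) -> X !=set0 ->
  (forall x, X x -> exists2 i, i \in s & f (p i) x <= 0) ->
  exists2 q, S q & forall x, X x -> f q x <= 0.
Proof.
move=> Sc fconv faff Xc Sp [x0 Xx0] Xs.
(* An index is secured before the induction, in which the shrinking set may become empty. *)
have [i0 _ _] := Xs _ Xx0.
elim: s X Xc {x0 Xx0} fconv faff Xs => [|i s IH] X Xc fconv faff Xs.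
  by exists (p i0) => // x /Xs[].
pose X' := [set x | X x /\ 0 < f (p i) x].
have [q Sq qX'] : exists2 q, S q & forall x, X' x -> f q x <= 0.
  apply: IH => [t x y t01 [Xx fx] [Xy fy]|t q r x t01 Sq Sr [Xx _]|q Sq t x y t01|x].
  - split; first exact: Xc.
    rewrite faff //; case/andP: t01 => t0 t1.
    have [->|tn0] := eqVneq t 0; first by rewrite mul0r subr0 mul1r add0r.
    have tp : 0 < t by rewrite lt_neqAle eq_sym tn0.
    apply: ltr_pwDl; first exact: mulr_gt0.
    by rewrite mulr_ge0 ?subr_ge0 // ltW.
  - exact: fconv.
  - by move=> [Xx _] [Xy _]; apply: faff.
  - case=> Xx; rewrite ltNge => nfx; have [j] := Xs _ Xx; rewrite inE.
    by case/predU1P => [->|js fj]; [rewrite (negPf nfx)|exists j].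
have [x Xx|t t01 tX] := @minimax2 X (f q) (f (p i)) Xc (faff _ Sq) (faff _ (Sp i)).
  by have [|lt] := leP (f (p i) x) 0; [right|left; apply: qX'].
exists (conv t q (p i)); first exact: Sc.
by move=> x Xx; apply: le_trans (tX x Xx); apply: fconv.
Qed.

End Minimax.

(** * Real parts of complex numbers *)

Section ComplexRe.
Context {R : realType}.
Implicit Types (z w : R[i]) (t : R).

Lemma cReD z w : complex.Re (z + w) = complex.Re z + complex.Re w.
Proof. by case: z w => [? ?] [? ?]. Qed.

Lemma cReB z w : complex.Re (z - w) = complex.Re z - complex.Re w.
Proof. by case: z w => [? ?] [? ?]. Qed.

Lemma cReZ t z : complex.Re (t%:C * z) = t * complex.Re z.
Proof. by case: z => [a b]; rewrite /= mul0r subr0. Qed.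

Lemma cRe_le z w : z <= w -> complex.Re z <= complex.Re w.
Proof. by rewrite lecE => /andP[]. Qed.

Lemma cReK z : 0 <= z -> (complex.Re z)%:C = z.
Proof. by move=> z0; apply/RRe_real/ger0_real. Qed.

Lemma cRe_continuous : continuous (@complex.Re R : R[i]^o -> R).
Proof.
move=> z; have Fz : Filter (nbhs (z : R[i]^o)) by apply: nbhs_filter.
apply/(@cvgrPdist_lt _ _ _ _ (fmap_filter _ Fz)) => e e0.
have := @nbhsx_ballx R[i] R[i]^o z e%:C; rewrite ltcR => /(_ e0).
apply: (@filterS _ _ Fz) => w; rewrite -ball_normE /= => zw.
rewrite -ltcR; apply: le_lt_trans zw.
apply: le_trans (normc_ge_Re _); rewrite lecR.
by rewrite cReB.
Qed.

End ComplexRe.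

(** Elements of X are bare functions; this gives them the linear structure that the lemmas on
    positive functionals expect. *)
Lemma scalar_pack (K : pzRingType) (V : lmodType K) (f : V -> K) :
  scalar f -> exists g : {scalar V}, f = g.
Proof.
move=> fL; pose g : {scalar V} := HB.pack f (GRing.isLinear.Build K V K *%R f fL).
by exists g.
Qed.

(** * Tracial states and the uniform 2-norm *)

Section Traces.
Context {R : realType} {M : cstarAlgType R}.
Implicit Types (X : set (M -> R[i])) (tau : M -> R[i]).

Definition mix (t : R) tau sigma : M -> R[i] :=
  fun a => t%:C * tau a + (1 - t%:C) * sigma a.

Lemma mix_convex X t tau sigma : convex_set (X : set (M -> R[i]^o)) ->
  0 <= t <= 1 -> X tau -> X sigma -> X (mix t tau sigma).
Proof.
move=> Xc /andP[t0 t1] Xt Xs.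
have t0' : 0 <= t%:C :> R[i] by rewrite ler0c.
have t1' : t%:C <= 1 :> R[i] by rewrite lecR.
have := Xc tau sigma (Itv01 t0' t1') (mem_set Xt) (mem_set Xs).
by rewrite inE.
Qed.

Lemma cRe_mix t tau sigma a :
  complex.Re (mix t tau sigma a) =
  t * complex.Re (tau a) + (1 - t) * complex.Re (sigma a).
Proof. by rewrite /mix cReD cReZ -[1 - t%:C](rmorphB (real_complex R) 1 t) cReZ. Qed.

(** The norm clause bounds tau on the unit ball. Scaling by [rnorm a + 1] instead of the norm avoids
    a division by 0. *)
Lemma tracial_state_bound tau a : tracial_state tau ->
  complex.Re `|tau a| <= rnorm a + 1.
Proof.
case=> /scalar_pack[f ->] _ _ sup1.
have na : `|a| = (rnorm a)%:C by rewrite cReK.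
have r0 : 0 <= rnorm a by rewrite -ler0c -na.
have r1 : 0 < rnorm a + 1 by lra.
pose k := (rnorm a + 1)^-1.
have k0 : 0 < k by rewrite invr_gt0.
have kn : `|k%:C| = k%:C :> R[i] by rewrite ger0_norm // ler0c ltW.
have kaE : rnorm (k%:C *: a) <= 1.
  by rewrite /rnorm normrZ kn cReZ mulrC ler_pdivrMr; lra.
have : ((complex.Re `|f (k%:C *: a)|)%:E <= 1%:E)%E.
  by rewrite -sup1; apply: ereal_sup_ubound; exists (k%:C *: a).
rewrite lee_fin (_ : f (k%:C *: a) = k%:C * f a); last exact: linearZ.
rewrite normrM kn cReZ mulrC ler_pdivrMr //.
by rewrite mul1r.
Qed.

(** The estimates of [norm2] need this, as [sup] is a least upper bound only for a nonempty bounded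
    set. *)
Lemma norm2_has_sup X a : X `<=` tracial_state -> X !=set0 ->
  has_sup [set Num.sqrt (complex.Re (tau (amul (adj a) a))) | tau in X].
Proof.
move=> XT [tau Xtau]; split; first by eexists; exists tau.
exists (Num.sqrt (rnorm (amul (adj a) a) + 1)) => _ [sigma Xs <-].
have [_ pos _ _] := XT _ Xs; apply: ler_wsqrtr.
have := tracial_state_bound (amul (adj a) a) (XT _ Xs).
by rewrite ger0_norm.
Qed.

Lemma norm2_ge X a tau : X `<=` tracial_state -> X tau ->
  complex.Re (tau (amul (adj a) a)) <= norm2 X a ^+ 2.
Proof.
move=> XT Xtau; have [_ pos _ _] := XT _ Xtau.
have hs := norm2_has_sup a XT (ex_intro _ _ Xtau).
have le_s : Num.sqrt (complex.Re (tau (amul (adj a) a))) <= norm2 X a.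
  by apply: (ub_le_sup hs.2); exists tau.
rewrite -[leLHS]sqr_sqrtr; last exact: cRe_le (pos a).
by rewrite ler_sqr ?nnegrE ?sqrtr_ge0 // (le_trans (sqrtr_ge0 _) le_s).
Qed.

Lemma norm2_ge0 X a : X `<=` tracial_state -> X !=set0 -> 0 <= norm2 X a.
Proof.
move=> XT X0; have [tau Xt] := X0; apply: le_trans (sqrtr_ge0 _) _; last first.
  by apply: (ub_le_sup (norm2_has_sup a XT X0).2); exists tau.
Qed.

Lemma norm2_le X a c : X !=set0 -> 0 <= c ->
  (forall tau, X tau -> complex.Re (tau (amul (adj a) a)) <= c ^+ 2) ->
  norm2 X a <= c.
Proof.
move=> [sigma Xs] c0 Xc; apply: ge_sup; first by eexists; exists sigma.
move=> _ [tau Xt <-]; rewrite -[c]ger0_norm // -sqrtr_sqr.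
exact/ler_wsqrtr/Xc.
Qed.

Lemma separating_state X a : X !=set0 ->
  is_norm (norm2 X) -> a != 0 ->
  X `<=` tracial_state -> exists2 tau, X tau & tau (amul (adj a) a) != 0.
Proof.
move=> X0 [_ _ Ndef] a0 XT; apply/not_exists2P => H.
move/eqP: a0; apply; apply: Ndef; apply/eqP; rewrite eq_le; apply/andP; split.
  apply: norm2_le => // tau Xt; case: (H tau) => // /negP/negPn/eqP ->.
  by rewrite expr2 mulr0.
exact: norm2_ge0.
Qed.

(* Replacing sigma by the average of sigma and tau, where tau does not vanish
   at the one null direction of sigma, extends faithfulness by one dimension. *)
Lemma faithful_state X (e : nat -> M) n : tracially_complete X -> X !=set0 ->
  exists2 sigma, X sigma & forall c : nat -> R[i],
    let y := \sum_(i < n) c i *: e i in sigma (amul (adj y) y) = 0 -> y = 0.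
Proof.
move=> [XT _ Xc XN _] X0; elim: n => [|n [sigma Xs IH]].
  by have [sigma Xs] := X0; exists sigma => // c y _; rewrite /y big_ord0.
pose sp (c : nat -> R[i]) := \sum_(i < n.+1) c i *: e i.
have [?|] := pselect (forall c, sigma (amul (adj (sp c)) (sp c)) = 0 -> sp c = 0).
  by exists sigma.
move=> /existsNP[c /not_implyP[sc0 /eqP c0]].
have [tau Xt tc0] := separating_state X0 XN c0 XT.
have half : 0 <= (2^-1 : R) <= 1 by apply/andP; split; lra.
exists (mix 2^-1 sigma tau); first exact: mix_convex.
have [/scalar_pack[s sE] sge0 _ _] := XT _ Xs; rewrite {}sE in sge0 IH sc0 *.
have [/scalar_pack[t tE] tge0 _ _] := XT _ Xt; rewrite {}tE in tge0 tc0 *.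
move=> d /=; rewrite -/(sp d) => /eqP.
have h0 : (2^-1)%:C != 0 :> R[i] by rewrite gt_eqF // ltcR; lra.
have h1 : 1 - (2^-1)%:C = (2^-1)%:C :> R[i].
  by rewrite -[1 - _](rmorphB (real_complex R) 1); congr (_%:C); lra.
have h_ge0 : 0 <= (2^-1)%:C :> R[i] by rewrite ler0c; lra.
rewrite /mix h1 paddr_eq0 ?mulr_ge0 // !mulf_eq0 (negPf h0) /=.
case/andP => /eqP sd0 /eqP td0.
have spS b : sp b = \sum_(i < n) b i *: e i + b n *: e n.
  by rewrite /sp big_ord_recr.
have cn0 : c n != 0.
  apply: contra_neq c0 => cn0; move: sc0; rewrite spS cn0 scale0r addr0.
  exact: IH.
(* Subtracting k times the null vector [sp c] clears the last coefficient of [sp d]. The difference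
   is null for sigma by the parallelogram law, so the induction hypothesis makes it 0. *)
have [k kE] : exists k, k * c n = d n by exists (d n / c n); rewrite divfK.
have wE : sp d - k *: sp c = \sum_(i < n) (d i - k * c i) *: e i.
  rewrite !spS scalerDr opprD addrACA scalerA kE subrr addr0.
  rewrite scaler_sumr -sumrB; apply: eq_bigr => i _.
  by rewrite scalerBl scalerA.
have w0 : sp d - k *: sp c = 0.
  rewrite wE; apply: (IH (fun i => d i - k * c i)); rewrite -wE.
  have := form_parallelogram (gnsDZr s) (gnsDZl s) sge0 (sp d) (k *: sp c).
  rewrite (formZr (gnsDZr s)) (formZl (gnsDZr s) (gnsDZl s) sge0) {3 4}/gns.
  rewrite sd0 sc0 !mulr0 addr0 => /eqP.
  by rewrite paddr_eq0 ?sge0 // => /andP[_ /eqP].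
move/eqP: w0; rewrite subr_eq0 => /eqP dE; rewrite dE.
have : gns t (k *: sp c) (k *: sp c) = 0 by rewrite -dE.
rewrite (formZr (gnsDZr t)) (formZl (gnsDZr t) (gnsDZl t) tge0) => /eqP.
rewrite !mulf_eq0 conjC_eq0 orbA orbb /gns (negPf tc0) orbF => /eqP ->.
by rewrite scale0r.
Qed.

End Traces.

(** * Approximation through one finite dimensional subalgebra *)

Section Approximation.
Context {R : realType} {M : cstarAlgType R} (X : set (M -> R[i])).
Hypothesis Xtc : tracially_complete X.
Hypothesis X0 : X !=set0.

Lemma faithful_on_sub (F : cstar_sub M) : fin_dim (sub_set F) ->
  exists2 sigma, X sigma & forall b : sub_alg F,
    sigma (amul (adj (sub_val b)) (sub_val b)) = 0 -> b = 0.
Proof.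
(* The spanning family is extended by 0 to all natural numbers. *)
case=> n [e Fe]; pose e' k := oapp e 0 (insub k).
have [sigma Xs sdef] := faithful_state e' n Xtc X0; exists sigma => // b.
have := elimT (sub_predP F _) (valP b); rewrite {1}Fe => -[c bE].
have -> : sub_val b = \sum_(i < n) oapp c 0 (insub (val i)) *: e' i.
  by rewrite [LHS]bE; apply: eq_bigr => i _; rewrite /e' !valK.
move=> /(sdef (fun k => oapp c 0 (insub k))) s0; apply/val_inj.
rewrite [LHS]bE -[RHS]s0; apply: eq_bigr => i _.
by rewrite /e' !valK.
Qed.

(** The expectation preserves the average of tau and sigma, which is faithful on F because it
    dominates half of sigma; it also dominates half of tau, whence the factor 2. *)
Lemma expectation_exists (F : cstar_sub M) sigma tau :
  fin_dim (sub_set F) -> X sigma ->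
  (forall b : sub_alg F,
    sigma (amul (adj (sub_val b)) (sub_val b)) = 0 -> b = 0) ->
  X tau ->
  exists psi : {linear M -> sub_alg F},
    [/\ completely_positive psi, forall b, psi (sub_val b) = b &
      forall x, complex.Re (tau (amul (adj (sub_val (psi x))) (sub_val (psi x))))
        <= 2 * norm2 X x ^+ 2].
Proof.
move=> Ffd Xs sdef Xt; have [XT _ Xc _ _] := Xtc.
have half : 0 <= (2^-1 : R) <= 1 by apply/andP; split; lra.
have Xr := mix_convex Xc half Xt Xs.
have rRe a : complex.Re (mix 2^-1 tau sigma a) =
    2^-1 * complex.Re (tau a) + 2^-1 * complex.Re (sigma a).
  by rewrite cRe_mix; congr (_ + _ * _); lra.
have [_ tge0 _ _] := XT _ Xt; have [_ sge0 _ _] := XT _ Xs.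
have Nge := fun a => norm2_ge a XT Xr.
have [/scalar_pack[r rE] rge0 rtrace _] := XT _ Xr.
rewrite {}rE in rge0 rtrace rRe Nge.
have rdef (b : sub_alg F) : sub_tau F r (amul (adj b) b) = 0 -> b = 0.
  move=> rb; apply: sdef; have sb := sge0 (sub_val b).
  have tb := cRe_le (tge0 (sub_val b)); have sb' := cRe_le sb.
  have := rRe (amul (adj (sub_val b)) (sub_val b)).
  rewrite [r _]rb /= => H.
  have : complex.Re (sigma (amul (adj (sub_val b)) (sub_val b))) = 0.
    by move: tb sb' => /=; lra.
  by move=> re0; rewrite -(cReK sb) re0.
have [m [u uE]] := gns_frame (tau := sub_tau F r) (fun a => rge0 (sub_val a)) rdef
  (sub_fin_dim Ffd).
exists (cond_exp r u); split.
- exact: cond_exp_cp.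
- exact: cond_exp_id.
move=> x; set v := sub_val _.
have := cRe_le (cond_exp_contractive rge0 uE x); rewrite -/v /gns => le1.
have le2 := Nge x; have := rRe (amul (adj v) v).
by have /= := cRe_le (sge0 v); lra.
Qed.

Lemma ptws_cover_compact (K : set {ptws M -> R[i]^o}) :
  compact K -> cover_compact K.
Proof.
pose T : ptopologicalType := HB.pack {ptws M -> R[i]^o}
  (isPointed.Build {ptws M -> R[i]^o} (fun=> 0)).
by move=> Kc; have := Kc : @compact T K; rewrite compact_cover.
Qed.

Lemma eval_continuous z :
  continuous (fun tau : {ptws M -> R[i]^o} => complex.Re (tau z) : R).
Proof.
move=> tau.
apply: (continuous_comp (f := fun t : {ptws M -> R[i]^o} => t z : R[i]^o)).
  exact: (@proj_continuous M (fun=> R[i]^o) z tau).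
exact: cRe_continuous.
Qed.

Lemma continuous_sum (T : topologicalType) (I : Type) (s : seq I)
    (F : I -> T -> R) :
  (forall i, continuous (F i)) -> continuous (fun x => \sum_(i <- s) F i x).
Proof.
move=> cF x; apply: cvg_big => [|i _]; [exact: add_continuous|exact: cF].
Qed.

Lemma open_eval_lt (s : seq M) (z : M -> M) (delta : R) :
  open [set tau : {ptws M -> R[i]^o} |
    \sum_(a <- s) complex.Re (tau (z a)) - delta < 0].
Proof.
pose g (tau : {ptws M -> R[i]^o}) : R :=
  \sum_(a <- s) complex.Re (tau (z a)).
rewrite (_ : [set _ | _] = g @^-1` [set r | r < delta]); last first.
  by apply/funext => tau; rewrite /= subr_lt0.
apply: (@open_comp _ _ g [set r | r < delta]); last exact: open_lt.
by move=> tau _; apply: continuous_sum => a; apply: eval_continuous.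
Qed.

Lemma cp_approximation (s : seq M) (eps : R) : hyperfinite X -> 0 < eps ->
  exists (F : cstar_sub M) (psi : {linear M -> sub_alg F}),
    [/\ fin_dim (sub_set F), completely_positive psi &
      forall a, a \in s -> norm2 X (sub_val (psi a) - a) < eps].
Proof.
move=> Xhf eps0; have [XT Xcomp Xc [Ntri Nhom _] _] := Xtc.
pose m := (size s)%:R : R; have m0 : 0 <= m by rewrite ler0n.
(* The final error is at most (m + 1) eta from [psi (d a)] plus less than eta from [d a]. *)
pose eta := eps / (m + 2); have eta0 : 0 < eta by rewrite divr_gt0; lra.
have etaE : eta * (m + 2) = eps by rewrite divfK // gt_eqF; lra.
have [F0 [subF Ffd Fs]] := Xhf [set` s] eta (finite_seq s) eta0.
pose F := CstarSub subF.
have {Fs} /choice[b bs] a : exists b : sub_alg F,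
    a \in s -> norm2 X (a - sub_val b) < eta.
  have [as_|nas] := boolP (a \in s); last by exists 0.
  have [_ /(sub_val_surj (F := F))[b <-] ab] := Fs a as_; by exists b.
(* A map psi that fixes the subalgebra satisfies psi a - a = psi (d a) - d a, so only [d a] has to
   be controlled. *)
pose d a := a - sub_val (b a).
have [sigma Xs sdef] := faithful_on_sub (F := F) Ffd.
(* For a single trace the summed squared errors are at most 2 m eta^2, strictly below this value by
   (m^2 + 1) eta^2. *)
pose delta := ((m + 1) * eta) ^+ 2.
pose sq (psi : {linear M -> sub_alg F}) a :=
  amul (adj (sub_val (psi (d a)))) (sub_val (psi (d a))).
(* The errors over s are added into one function, affine in tau; being nonnegative, each is bounded
   by the sum. *)
pose f psi (tau : M -> R[i]) :=
  \sum_(a <- s) complex.Re (tau (sq psi a)) - delta.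
pose S : set {linear M -> sub_alg F} :=
  [set psi | completely_positive psi /\ forall c, psi (sub_val c) = c].
have /choice[p pP] (tau : {ptws M -> R[i]^o}) :
    exists psi, S psi /\ (X tau -> f psi tau < 0).
  have small tau' : X tau' -> exists psi, S psi /\ f psi tau' < 0.
    move=> Xt; have [psi [cp id_psi bd]] := expectation_exists (F := F) Ffd Xs sdef Xt.
    exists psi; split=> //; rewrite subr_lt0.
    apply: (@le_lt_trans _ _ (\sum_(a <- s) 2 * eta ^+ 2)).
      rewrite big_seq [leRHS]big_seq; apply: ler_sum => a as_.
      apply: le_trans (bd _) _; rewrite ler_pM2l //.
      by rewrite ler_sqr ?nnegrE ?norm2_ge0 // ltW // bs.
    rewrite big_const_seq count_predT iter_addr_0 -mulr_natl -/m /delta.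
    have : 0 < (m ^+ 2 + 1) * eta ^+ 2 by rewrite mulr_gt0 ?exprn_gt0 //; nra.
    by rewrite -[_ < (_ * eta) ^+ 2]subr_gt0; congr (0 < _); ring.
  (* Outside X the map found for sigma serves as a default. *)
  have [/small[psi [Sp fp]]|nX] := pselect (X tau); first by exists psi.
  by have [psi [Sp _]] := small _ Xs; exists psi.
pose conv (t : R) (q r : {linear M -> sub_alg F}) : {linear M -> sub_alg F} :=
  (t%:C \*: q \+ (1 - t%:C) \*: r)%R.
have Xcover : @cover_compact {ptws M -> R[i]^o} X by exact: ptws_cover_compact.
(* Each trace of X lies in the open set where its own map [p t0] has small error; finitely many of
   these sets cover X. *)
have := Xcover {ptws M -> R[i]^o} X; move=> /(_ (fun t0 => [set t | f (p t0) t < 0])).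
case.
- by move=> t0 _; apply: open_eval_lt.
- by move=> t Xt; exists t => //; apply: (pP t).2.
move=> D DX Dcov.
have [psi [psicp psi_id] psi_small] : exists2 q, S q & forall x, X x -> f q x <= 0.
  apply: (@kneser_minimax R _ (@mix R M) _ S conv f _ p (finmap.enum_fset D)) => //.
  - move=> t q r /andP[t0 t1] [qcp qid] [rcp rid]; split.
      have [_ sge0 _ _] := XT _ Xs; have [/scalar_pack[r' rE] _ _ _] := XT _ Xs.
      rewrite rE in sge0 sdef.
      apply: (completely_positive_combination (tau := sub_tau F r')) => //.
      - by move=> c; apply: sge0.
      - exact: sub_fin_dim.
      - by rewrite ler0c.
      - by rewrite subr_ge0 lecR.
    by move=> c; rewrite /= qid rid -scalerDl addrC subrK scale1r.
  - move=> t q r tau /andP[t0 t1] _ _ Xt; rewrite /f.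
    have [/scalar_pack[g gE] gge0 _ _] := XT _ Xt; rewrite {}gE in gge0 *.
    have t0C : 0 <= t%:C :> R[i] by rewrite ler0c.
    have t1C : (1 - t)%:C = 1 - t%:C :> R[i] by rewrite rmorphB rmorph1.
    have sq_le a : complex.Re (g (sq (conv t q r) a)) <=
        t * complex.Re (g (sq q a)) + (1 - t) * complex.Re (g (sq r a)).
      rewrite -!cReZ -cReD t1C; apply: cRe_le; rewrite -subr_ge0.
      have tr : (t%:C)^* = t%:C by rewrite conj_Creal // ger0_real.
      have := form_convex (gnsDZr g) (gnsDZl g) gge0
        (sub_val (q (d a))) (sub_val (r (d a))) tr.
      have -> : t%:C *: sub_val (q (d a)) + (1 - t%:C) *: sub_val (r (d a)) =
        sub_val (conv t q r (d a)) by [].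
      rewrite {1}/gns => ->.
      have : 0 <= t%:C * (1 - t%:C) * gns g (sub_val (q (d a)) - sub_val (r (d a)))
          (sub_val (q (d a)) - sub_val (r (d a))).
        by rewrite !mulr_ge0 ?gge0 // -t1C ler0c subr_ge0.
      by rewrite /gns /sq; congr (0 <= _); ring.
    have := ler_sum s (P := predT) (fun a _ => sq_le a).
    by rewrite big_split -!mulr_sumr /=; lra.
  - move=> q _ t x y _ Xx Xy; rewrite /f.
    under eq_bigr => a _ do rewrite cRe_mix.
    by rewrite big_split -!mulr_sumr /=; ring.
  - by move=> t x y t01 Xx Xy; apply: mix_convex.
  - by move=> t; have [] := pP t.
  - by move=> tau /Dcov[t0 /= t0D ft]; exists t0 => //; exact: ltW.
exists F, psi; split=> // a as_.
have -> : sub_val (psi a) - a = sub_val (psi (d a)) + (-1) *: d a.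
  rewrite /d scaleN1r (raddfB psi) /= psi_id (raddfB (@sub_val _ _ F)) /=.
  by rewrite opprB addrA subrK.
apply: le_lt_trans (Ntri _ _) _; rewrite Nhom normrN1 mul1r.
have : norm2 X (sub_val (psi (d a))) <= (m + 1) * eta.
  apply: norm2_le => //; first by rewrite mulr_ge0; lra.
  move=> tau Xt; have := psi_small _ Xt; rewrite subr_le0; apply: le_trans.
  have [_ tge0 _ _] := XT _ Xt.
  rewrite (big_rem a) //= lerDl sumr_ge0 // => c _.
  exact: cRe_le (tge0 _).
by move: (bs a as_) etaE; rewrite -/(d a); nra.
Qed.

End Approximation.

(** * Assembling the nets *)

Theorem theorem8p2 (R : realType) (M : cstarAlgType R) (X : set (M -> R[i]%C)) :
  tracially_complete X -> hyperfinite X -> amenable X.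
Proof.
(* For empty X the function [norm2 X] vanishes; as it is a norm, M is zero and identity maps
   suffice. *)
move=> Xtc Xhf; have [X0|/set0P X0] := eqVneq X set0.
  have [_ _ _ [_ _ Ndef] _] := Xtc.
  have N0 (a : M) : norm2 X a = 0 by rewrite /norm2 X0 image_set0 sup0.
  have M0 (a : M) : a = 0 by apply: Ndef.
  exists unit, (fun _ _ => True), (fun=> M), (fun=> idfun), (fun=> idfun).
  have cp : completely_positive (idfun : {linear M -> M}).
    by move=> n a apos; rewrite map_mx_id.
  split=> //.
    move=> _; exists 0%N, (fun=> 0); apply/seteqP; split=> // a _.
    by exists (fun=> 0); rewrite big_ord0.
  by move=> a eps eps0; exists tt => l _; rewrite N0.
(* An index consists of a finite list of elements and a number n that encodes the tolerance
   1/(n+1). *)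
have step (l : seq M * nat) : exists Fpsi : {F : cstar_sub M & {linear M -> sub_alg F}},
    [/\ fin_dim (sub_set (projT1 Fpsi)), completely_positive (projT2 Fpsi) &
      forall a, a \in l.1 -> norm2 X (sub_val (projT2 Fpsi a) - a) < l.2.+1%:R^-1].
  have e0 : 0 < l.2.+1%:R^-1 :> R by rewrite invr_gt0.
  by have [F [psi H]] := cp_approximation Xtc X0 l.1 Xhf e0; exists (existT _ F psi).
have {step} [G GP] := choice step.
(* Lists are compared by their sets of members; concatenation and maximum give upper bounds. *)
exists (seq M * nat)%type, (fun l l' => {subset l.1 <= l'.1} /\ (l.2 <= l'.2)%N),
  (fun l => sub_alg (projT1 (G l))), (fun l => projT2 (G l)),
  (fun l => sub_val (F := projT1 (G l))).
split.
- split.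
  + exact: (inhabits ([::], 0%N)).
  + by move=> l; split.
  + move=> i j k [ij1 ij2] [jk1 jk2]; split; last exact: leq_trans jk2.
    by move=> a /ij1/jk1.
  + move=> i j; exists (i.1 ++ j.1, maxn i.2 j.2); rewrite /= leq_maxl leq_maxr.
    by split; split=> // a aij; rewrite mem_cat aij ?orbT.
- by move=> l; have [/sub_fin_dim] := GP l.
- by move=> l; have [] := GP l.
- by move=> l; apply: sub_val_cp.
move=> a eps eps0.
have [n ne] : exists n : nat, n.+1%:R^-1 < eps.
  pose n := Num.truncn eps^-1; exists n.
  by rewrite invf_plt ?posrE ?ltr0n // truncnS_gt ?num_real.
exists ([:: a], n) => l [al nl]; have [_ _ /(_ a)] := GP l.
move=> /(_ (al a (mem_head _ _))) /lt_le_trans; apply.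
apply: le_trans (ltW ne); rewrite lef_pV2 ?posrE //.
by rewrite ler_nat.
Qed.
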